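(* For every $m\ge m_*$, the $q$-state tails $\mathbf G_m(\tau)$ satisfy the following identity of matrix-valued formal power series in $\tau$: \[ \mathbf G_m(\tau)=\Bigl(I_q-\tau\mathbf A_m-\sum_{\eta\in\mathcal I_+}\tau^{\eta+1}\,\mathbf B_m\mathbf G_{m+1}(\tau)\,\mathbf B_{m+1}\mathbf G_{m+2}(\tau)\cdots\mathbf B_{m+\eta-1}\mathbf G_{m+\eta}(\tau)\,\mathbf D_m^{(\eta)}\Bigr)^{-1}. \] When $\eta=1$, the alternating product in the summand is just $\mathbf B_m\mathbf G_{m+1}(\tau)$. If $\sigma=0$, then $\mathbf D_m^{(\kappa+1)}=0$. If $\kappa=0$, the depth-zero falls are included in $\mathbf A_m$, which is why $0\notin\mathcal I_+$.
   Context: Let $p,q\ge1$, $M=p+q$, $d=\gcd(p,q)$, $P=p/d$, $Q=q/d$, $R=P+Q$. Let $L_1,\dots,L_p$ be semi-infinite (indexed by $\mathbb N_0$) lower bidiagonal matrices with $(L_a)_{n,n}=1$, $(L_a)_{n+1,n}=\ell_n^{(a)}$, and $U_1,\dots,U_q$ upper bidiagonal with $(U_b)_{n,n}=u_n^{(b)}$, $(U_b)_{n,n+1}=1$. Height-ordered matrix $\mathscr H$ of the order $L_1,\dots,L_p,U_q,\dots,U_1$: put $\omega_j=(j-1)Q$ for $1\le j\le p$ and $\omega_{p+b}=(q-b+1)P$ for $1\le b\le q$. Rows and columns are indexed by pairs $(h,j)$ (''states of height $h$'') with $h\in\mathbb N_0$, $j\in\{1,\dots,M\}$, $h-\omega_j\in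 R\mathbb N_0$, ordered by $h$ and then $j$; $n_j(h)=(h-\omega_j)/R$; $j^+=j+1$ for $j<M$, $M^+=1$. The only nonzero entries are $\mathscr H_{(h,j),(h+Q,j^+)}=1$; $\mathscr H_{(h,j),(h-P,j^+)}=\ell^{(j)}_{n_j(h)-1}$ for $1\le j\le p$, $n_j(h)\ge1$; $\mathscr H_{(h,p+b),(h-P,(p+b)^+)}=u^{(q-b+1)}_{n_{p+b}(h)}$ for $1\le b\le q$. The entries with displacement $-P$ are called falls. Set $m_*=p$ (for $q=1$ one takes $m_*=0$). For $m\ge m_*$ each of the heights $mQ,\dots,(m+1)Q-1$ carries exactly $d$ states, so the span $\mathcal U_m$ of the coordinate vectors of states with $mQ\le h<(m+1)Q$ has dimension $q=dQ$. Let $E_m$ be the coordinate isometry from $\mathbb C^q$ onto $\mathcal U_m$ (columns ordered by the states), and let $\mathscr H^{\langle m\rangle_Q}$ be the principal submatrix of $\mathscr H$ on the states of height $\ge mQ$. Define $\mathbf G_m(\tau)=E_m^{\mathsf T}(I-\tau\mathscr H^{\langle m\rangle_Q})^{-1}E_m\in\mathbb C[[\tau]]^{q\times q}$ (formal Neumann series). Euclidean division: $P=\kappa Q+\sigma$ with $\kappa\in\mathbb N_0$ and $\sigma\in\{0,\dots,Q-1\}$. Define the $q\times q$ matrices $\mathbf A_m=E_m^{\mathsf T}\mathscr HE_m$, $\mathbf B_m=E_m^{\mathsf T}\mathscr HE_{m+1}$, $\mathbf D_m^{(\eta)}=E_{m+\eta}^{\mathsf T}\mathscr HE_m$ for $\eta\in\{\kappa,\kappa+1\}$,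 and $\mathcal I_+=\{\eta\in\{\kappa,\kappa+1\}:\eta\ge1\}$. *)

(* Defs.v *)
From HB Require Import structures.
From mathcomp Require Import all_boot all_order all_algebra.
From mathcomp Require Import boolp classical_sets fsbigop reals.
From mathcomp Require Import complex.

Set Implicit Arguments.
Unset Strict Implicit.
Unset Printing Implicit Defensive.

Import GRing.Theory.
Local Open Scope ring_scope.

(** * Formal power series *)

Record fps (K : Type) := Fps { fpscoef : nat -> K }.

Lemma fpscoefK (K : Type) : cancel (@fpscoef K) (@Fps K).
Proof. by case. Qed.

Lemma fpsP (K : Type) (f g : fps K) : fpscoef f =1 fpscoef g <-> f = g.
Proof.
split=> [|-> //]; case: f g => f [g] /= fg.
by congr Fps; apply/funext.
Qed.

HB.instance Definition _ (K : Type) := gen_eqMixin (fps K).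
HB.instance Definition _ (K : Type) := gen_choiceMixin (fps K).

Section FpsZmodule.
Variable K : zmodType.
Implicit Types f g h : fps K.

Definition fps_zero : fps K := Fps (fun=> 0).
Definition fps_opp f := Fps (fun n => - fpscoef f n).
Definition fps_add f g := Fps (fun n => fpscoef f n + fpscoef g n).

Lemma fps_addA : associative fps_add.
Proof. by move=> f g h; apply/fpsP => n /=; rewrite addrA. Qed.
Lemma fps_addC : commutative fps_add.
Proof. by move=> f g; apply/fpsP => n /=; rewrite addrC. Qed.
Lemma fps_add0 : left_id fps_zero fps_add.
Proof. by move=> f; apply/fpsP => n /=; rewrite add0r. Qed.
Lemma fps_addN : left_inverse fps_zero fps_opp fps_add.
Proof. by move=> f; apply/fpsP => n /=; rewrite addNr. Qed.

HB.instance Definition _ :=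
  GRing.isZmodule.Build (fps K) fps_addA fps_addC fps_add0 fps_addN.
End FpsZmodule.

Section FpsRing.
Variable K : comNzRingType.
Implicit Types f g h : fps K.

Definition fps_const (a : K) : fps K := Fps (fun n => if n == 0%N then a else 0).
Definition fps_mul f g : fps K :=
  Fps (fun n => \sum_(i < n.+1) fpscoef f i * fpscoef g (n - i)%N).

(* The ring axioms are transferred from {poly K} by truncation. *)
Let trunc N f : {poly K} := \poly_(i < N) fpscoef f i.

Let trunc_mul N f g n : (n < N)%N ->
  fpscoef (fps_mul f g) n = (trunc N f * trunc N g)`_n.
Proof.
move=> nN; rewrite coefM [LHS]/=; apply: eq_bigr => i _; rewrite !coef_poly.
by rewrite (leq_trans (ltn_ord i) nN) (leq_ltn_trans (leq_subr i n) nN).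
Qed.

Lemma fps_mulC : commutative fps_mul.
Proof.
by move=> f g; apply/fpsP => n; rewrite 2!(trunc_mul _ _ (ltnSn n)) mulrC.
Qed.

Let trunc_mul3 f g h n : fpscoef (fps_mul f (fps_mul g h)) n =
  (trunc n.+1 f * (trunc n.+1 g * trunc n.+1 h))`_n.
Proof.
rewrite coefM [LHS]/=; apply: eq_bigr => i _; rewrite coef_poly ltn_ord.
by congr (_ * _); apply: trunc_mul; rewrite ltnS leq_subr.
Qed.

Lemma fps_mulA : associative fps_mul.
Proof.
move=> f g h; apply/fpsP => n; rewrite [in RHS]fps_mulC !trunc_mul3.
by rewrite mulrA mulrC.
Qed.

Lemma fps_mul1 : left_id (fps_const 1) fps_mul.
Proof.
move=> f; apply/fpsP => n; rewrite /= big_ord_recl /= mul1r subn0 big1 ?addr0 //.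
by move=> i _; rewrite mul0r.
Qed.

Lemma fps_mulD : left_distributive fps_mul +%R.
Proof.
move=> f g h; apply/fpsP => n; rewrite /= -big_split /=.
by apply: eq_bigr => i _; rewrite mulrDl.
Qed.

Lemma fps_oner_neq0 : fps_const 1 != 0 :> fps K.
Proof.
by apply/eqP => /fpsP /(_ 0%N) /= /eqP; rewrite oner_eq0.
Qed.

HB.instance Definition _ := GRing.Zmodule_isComNzRing.Build (fps K)
  fps_mulA fps_mulC fps_mul1 fps_mulD fps_oner_neq0.

Lemma fpscoefM f g n :
  fpscoef (f * g) n = \sum_(i < n.+1) fpscoef f i * fpscoef g (n - i)%N.
Proof. by []. Qed.
Lemma fpscoefD f g n : fpscoef (f + g) n = fpscoef f n + fpscoef g n.
Proof. by []. Qed.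
Lemma fpscoefB f g n : fpscoef (f - g) n = fpscoef f n - fpscoef g n.
Proof. by []. Qed.
Lemma fpscoef1 n : fpscoef (1 : fps K) n = (n == 0%N)%:R.
Proof. by rewrite [LHS]/=; case: n. Qed.
Lemma fpscoef_sum (I : Type) (r : seq I) (P : pred I) (F : I -> fps K) n :
  fpscoef (\sum_(i <- r | P i) F i) n = \sum_(i <- r | P i) fpscoef (F i) n.
Proof. by elim/big_rec2: _ => // i y x _ <-. Qed.

Lemma fpscoefXn_lt g k n : fpscoef g 0 = 0 -> (n < k)%N -> fpscoef (g ^+ k) n = 0.
Proof.
move=> g0; elim: k n => // k IH n nk; rewrite exprS fpscoefM big1 // => -[[|i] /= ilt] _.
  by rewrite g0 mul0r.
by rewrite IH ?mulr0 //; case: n nk ilt => // n; rewrite !ltnS subSS => nk _;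
   apply: leq_ltn_trans nk; rewrite leq_subr.
Qed.

Definition fpsX : fps K := Fps (fun n => (n == 1%N)%:R).
End FpsRing.

Section FpsUnitRing.
Variable K : comUnitRingType.
Implicit Types f g h : fps K.

Definition fps_unit : pred (fps K) := [pred f | fpscoef f 0 \is a GRing.unit].

(* Geometric series in 1 - c f, where c is the inverse of the constant term. *)
Definition fps_inv f : fps K :=
  if f \in fps_unit then
    let c := fps_const (fpscoef f 0)^-1 in
    Fps (fun n => fpscoef (c * \sum_(k < n.+1) (1 - c * f) ^+ k) n)
  else f.

Lemma fps_mulVf : {in fps_unit, left_inverse 1 fps_inv *%R}.
Proof.
move=> f fu; rewrite mulrC /fps_inv fu; set c := fps_const _; set g := 1 - c * f.
have g0 : fpscoef g 0 = 0.
  by rewrite fpscoefB fpscoef1 fpscoefM big_ord1 /= mulVr // subrr.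
apply/fpsP => n.
transitivity (fpscoef (f * (c * \sum_(k < n.+1) g ^+ k)) n).
  have cE N r : (r <= N)%N -> fpscoef (c * \sum_(k < r.+1) g ^+ k) r =
      fpscoef (c * \sum_(k < N.+1) g ^+ k) r.
    move=> rN; rewrite [LHS]fpscoefM [RHS]fpscoefM; apply: eq_bigr => j _.
    congr (_ * _); rewrite !fpscoef_sum.
    rewrite (big_ord_widen N.+1 (fun k : nat => fpscoef (g ^+ k) (r - j)%N)) //.
    rewrite [RHS](bigID (fun k : 'I_N.+1 => (k < r.+1)%N)) /=.
    rewrite [X in _ = _ + X]big1 ?addr0 // => k; rewrite -leqNgt => rk.
    by apply: fpscoefXn_lt => //; apply: leq_ltn_trans rk; rewrite leq_subr.
  rewrite [LHS]fpscoefM [RHS]fpscoefM; apply: eq_bigr => i _; congr (_ * _).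
  by apply: cE; rewrite leq_subr.
have -> : f * (c * \sum_(k < n.+1) g ^+ k) = 1 - g ^+ n.+1.
  have cfE : c * f = 1 - g by rewrite /g opprB addrC subrK.
  by rewrite mulrA (mulrC f) cfE -[RHS]opprB subrX1 -mulNr [- (g - 1)]opprB.
by rewrite fpscoefB fpscoefXn_lt // subr0.
Qed.

Lemma fps_unitPl f g : g * f = 1 -> f \in fps_unit.
Proof.
move=> /fpsP /(_ 0%N); rewrite fpscoefM big_ord1 fpscoef1 /= => gf1.
by rewrite inE; apply/unitrPr; exists (fpscoef g 0%N); rewrite mulrC.
Qed.

Lemma fps_inv_out : {in [predC fps_unit], fps_inv =1 id}.
Proof. by move=> f; rewrite /fps_inv inE /= => /negbTE ->. Qed.

HB.instance Definition _ := GRing.ComNzRing_hasMulInverse.Build (fps K)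
  fps_mulVf fps_unitPl fps_inv_out.
End FpsUnitRing.

(** * Infinite matrices *)

Definition imx (K I J : Type) := I -> J -> K.

Definition itr (K I J : Type) (A : imx K I J) : imx K J I := fun j i => A i j.

(* The sum is over the (finite) support of the summand; only products whose
   left factor has finitely supported rows occur below. *)
Definition imul (K : nzRingType) (I : Type) (J : choiceType) (L : Type)
    (A : imx K I J) (B : imx K J L) : imx K I L :=
  fun i l => \sum_(j \in [set: J]%classic) A i j * B j l.

Definition ione (K : nzRingType) (I : eqType) : imx K I I :=
  fun i j => (i == j)%:R.

Definition ipow (K : nzRingType) (I : choiceType) (A : imx K I I) (n : nat) :
  imx K I I := iter n (imul A) (@ione K I).

(* The formal Neumann series of (I - tau A)^-1. *)
Definition neumann (K : nzRingType) (I : choiceType) (A : imx K I I) :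
  imx (fps K) I I := fun i j => Fps (fun n => ipow A n i j).

Definition finmx (K : Type) (m n : nat) (A : imx K 'I_m 'I_n) : 'M[K]_(m, n) :=
  \matrix_(i, j) A i j.

(** * The height-ordered matrix *)

Section Heights.
Variables p q : nat.

Definition hd : nat := gcdn p q.
Definition hP : nat := p %/ hd.
Definition hQ : nat := q %/ hd.
Definition hR : nat := hP + hQ.
Definition kappa : nat := hP %/ hQ.
Definition sigma : nat := hP %% hQ.

(* The index j in {1, ..., p + q} is represented by j - 1 : 'I_(p + q), so that
   [split] gives a - 1 for j = a <= p and b - 1 for j = p + b; likewise a and b
   are shifted by one in all the families indexed by 'I_p and 'I_q. *)
Definition omega (j : 'I_(p + q)) : nat :=
  match split j with
  | inl a => a * hQ
  | inr b => (q - b) * hP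
  end.

Definition is_state (s : nat * 'I_(p + q)) : bool :=
  (omega s.2 <= s.1)%N && (hR %| s.1 - omega s.2)%N.

Definition state : Type := {s : nat * 'I_(p + q) | is_state s}.
HB.instance Definition _ := Countable.on state.

Definition height (s : state) : nat := (val s).1.
Definition index_of (s : state) : 'I_(p + q) := (val s).2.
Definition level (s : state) : nat := (height s - omega (index_of s)) %/ hR.

Definition mstar : nat := if q == 1%N then 0%N else p.

(* The states with m Q <= h < (m + 1) Q, by increasing h, then increasing j. *)
Definition block (m : nat) : seq state :=
  pmap insub [seq (h, j) | h <- iota (m * hQ) hQ, j <- enum 'I_(p + q)].

Definition tail_state (m : nat) : Type := {s : state | (m * hQ <= height s)%N}.
HB.instance Definition _ (m : nat) := Countable.on (tail_state m).

Section Matrices.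
Variables (K : comUnitRingType).
Variables (l : 'I_p -> nat -> K) (u : 'I_q -> nat -> K).

Definition fall_weight (s : state) : K :=
  match split (index_of s) with
  | inl a => if (0 < level s)%N then l a (level s).-1 else 0
  | inr b => u (rev_ord b) (level s)
  end.

Definition Hmx : imx K state state := fun s t =>
  if index_of t != ordS (index_of s) then 0
  else if (height t == height s + hQ)%N then 1
  else if (height t + hP == height s)%N then fall_weight s
  else 0.

Definition Htail (m : nat) : imx K (tail_state m) (tail_state m) :=
  fun s t => Hmx (val s) (val t).

(* Column i is the coordinate vector of the i-th state of the block m. *)
Definition Emx (A : nzRingType) (m : nat) : imx A state 'I_q :=
  fun s i => (onth (block m) i == Some s)%:R.

Definition Etail (A : nzRingType) (m : nat) : imx A (tail_state m) 'I_q :=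
  fun s i => Emx A m (val s) i.

Definition Gmx (m : nat) : 'M[fps K]_q :=
  finmx (imul (imul (itr (@Etail (fps K) m)) (neumann (@Htail m)))
              (@Etail (fps K) m)).

Definition Hblock (m n : nat) : 'M[K]_q :=
  finmx (imul (imul (itr (Emx K m)) Hmx) (Emx K n)).

Definition Amx (m : nat) : 'M[K]_q := Hblock m m.
Definition Bmx (m : nat) : 'M[K]_q := Hblock m m.+1.
Definition Dmx (m eta : nat) : 'M[K]_q := Hblock (m + eta) m.

Definition Iplus : seq nat := [seq eta <- [:: kappa; kappa.+1] | (1 <= eta)%N].

Definition constmx (X : 'M[K]_q) : 'M[fps K]_q := map_mx (@fps_const K) X.

(* B_m G_{m+1} B_{m+1} G_{m+2} ... B_{m+eta-1} G_{m+eta} *)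
Definition BGprod (m eta : nat) : 'M[fps K]_q :=
  \big[mulmx/1%:M]_(k < eta) (constmx (Bmx (m + k)) *m Gmx (m + k).+1).

End Matrices.
End Heights.

(* Main.v *)
Require Import Defs.
From mathcomp Require Import all_boot all_order all_algebra.
From mathcomp Require Import boolp classical_sets fsbigop reals complex zify.

Set Implicit Arguments.
Unset Strict Implicit.
Unset Printing Implicit Defensive.

Import GRing.Theory.
Local Open Scope ring_scope.

(** The entries of the tail [Gmx l u m] are generating functions, by length, of
the weighted walks along the nonzero entries of the height-ordered matrix that
start and end in block [m] (heights in [m Q, (m + 1) Q)) and never leave the
blocks of index at least [m].  A step either climbs exactly one block or falls
by [kappa] or [kappa + 1] blocks.  A walk from block [m] back to block [m] is
thus a sequence of steps inside the block ([Amx]) and of excursions: climb to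
block [m + 1], stay above block [m] until some block [m + eta], then fall back
to block [m] through [Dmx m eta].  Because climbs cannot skip a block, the part
of an excursion between the climb and the fall is cut by the last visits to
the blocks [m + 1], ..., [m + eta - 1]; this gives the alternating product
[BGprod l u m eta].  Summing a geometric series over the number of returns
gives the inverse.

The walks themselves are never manipulated.  Write [F m a b] for the series of
walks from block [a] to block [b] inside the tail [m].  Cutting off the first
step gives a linear system [X a = Y a + tau * sum_c H a c X c], which has a
unique solution because the factor [tau] determines the coefficients one after
the other ([step_unique]).  Each combinatorial decomposition is then the remark
that both of its sides solve the same system: [last_visit] (at the last time in
block [m]) and [first_entrance] (at the first time in block [m]).  Iterating
the former gives the alternating products ([ascent]), and both together show
that the matrix to be inverted, multiplied by [G m], is the identity
([tail_recursion]).

This argument needs every block of index [m >= mstar] to consist of exactly [q]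
states.  Modulo [R], the numbers [omega j + q Q] are the multiples
[0, Q, ..., (p + q - 1) Q], and since [Q] is prime to [R] and [p + q = d R],
each residue is met [d] times ([count_residue]); the bound [m >= mstar] makes
the condition [omega j <= h] automatic ([is_stateE]). *)

(** * Last and first visits for a block matrix that climbs one block at a time *)

Lemma constmx0 (K : comUnitRingType) q : constmx (0 : 'M[K]_q) = 0.
Proof. by apply/matrixP => i j; rewrite !mxE; apply/fpsP => -[]. Qed.

Section BlockHessenberg.
Variables (K : comUnitRingType) (q : nat) (H : nat -> nat -> 'M[K]_q).
Implicit Types (m a b c : nat) (X Y Z : nat -> 'M[fps K]_q).
Local Notation tau := (fpsX K).

Lemma fpscoefXM (f : fps K) n :
  fpscoef (tau * f) n = if n is n'.+1 then fpscoef f n' else 0.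
Proof.
rewrite fpscoefM; case: n => [|n]; first by rewrite big_ord1 /= mul0r.
rewrite 2!big_ord_recl big1 /= ?mul0r ?add0r ?addr0 ?mul1r ?subn1 //.
by move=> i _; rewrite mul0r.
Qed.

Lemma fpscoefCM (x : K) (f : fps K) n :
  fpscoef (fps_const x * f) n = x * fpscoef f n.
Proof.
rewrite fpscoefM big_ord_recl big1 /= ?addr0 ?subn0 //.
by move=> i _; rewrite mul0r.
Qed.

(** Only the blocks up to [a + 1] appear in the sum: from block [a], a single
step climbs to block [a + 1] at most. *)
Definition step m a X : 'M[fps K]_q :=
  tau *: \sum_(m <= c < a.+2) constmx (H a c) *m X c.

Lemma fpscoef_step m a X i j n : fpscoef (step m a X i j) n =
  if n is n'.+1 then
    \sum_(m <= c < a.+2) \sum_k H a c i k * fpscoef (X c k j) n'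
  else 0.
Proof.
rewrite mxE fpscoefXM; case: n => // n.
rewrite summxE fpscoef_sum; apply: eq_bigr => c _.
rewrite mxE fpscoef_sum; apply: eq_bigr => k _.
by rewrite mxE fpscoefCM.
Qed.

Lemma fpscoef_affine m a X Y i j n : X a = Y a + step m a X ->
  fpscoef (X a i j) n = fpscoef (Y a i j) n +
    (if n is n'.+1 then
       \sum_(m <= c < a.+2) \sum_k H a c i k * fpscoef (X c k j) n'
     else 0).
Proof.
move=> ->; rewrite mxE fpscoefD.
exact: (congr1 (fun z => _ + z) (fpscoef_step m a X i j n)).
Qed.

(** The coefficient of degree [n + 1] of a solution is determined by its
coefficients of degree [n], because [step] carries a factor [tau]. *)
Lemma step_unique m Y X Z :
    (forall a, (m <= a)%N -> X a = Y a + step m a X) ->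
    (forall a, (m <= a)%N -> Z a = Y a + step m a Z) ->
  forall a, (m <= a)%N -> X a = Z a.
Proof.
move=> eX eZ a ma; apply/matrixP => i j; apply/fpsP => n.
elim: n a ma i => [|n IH] a ma i;
  rewrite (fpscoef_affine _ _ _ (eX a ma)) (fpscoef_affine _ _ _ (eZ a ma)) //.
congr (_ + _); rewrite !big_nat; apply: eq_bigr => c /andP[mc _].
by apply: eq_bigr => k _; rewrite IH.
Qed.

Lemma stepMr m a X (M : 'M[fps K]_q) :
  step m a (fun c => X c *m M) = step m a X *m M.
Proof.
rewrite /step -scalemxAl mulmx_suml; congr (_ *: _).
by apply: eq_bigr => c _; rewrite mulmxA.
Qed.

Lemma stepD m a X Y : step m a (fun c => X c + Y c) = step m a X + step m a Y.
Proof.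
rewrite /step -scalerDr -big_split; congr (_ *: _).
by apply: eq_bigr => c _; rewrite mulmxDr.
Qed.

Lemma step_sum m a (I : Type) (r : seq I) (X : I -> nat -> 'M[fps K]_q) :
  step m a (fun c => \sum_(i <- r) X i c) = \sum_(i <- r) step m a (X i).
Proof.
rewrite /step -scaler_sumr exchange_big; congr (_ *: _).
by apply: eq_bigr => c _; rewrite mulmx_sumr.
Qed.

Lemma stepSl m a X : (m <= a.+1)%N ->
  step m a X = tau *: (constmx (H a m) *m X m) + step m.+1 a X.
Proof. by move=> ma; rewrite /step big_ltn // scalerDr. Qed.

Variables (m0 : nat) (F : nat -> nat -> nat -> 'M[fps K]_q).
Hypothesis first_step : forall m a b, (m0 <= m)%N -> (m <= a)%N ->
  F m a b = (a == b)%:R%:M + step m a (F m ^~ b).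

(** A walk from block [m] to a higher block [b] splits at its last visit to
block [m]: it then climbs to block [m + 1] and stays above block [m].  The
uniqueness argument needs all starting blocks [a >= m]; those above [m] also
have the walks that never meet block [m], whence the extra term in [X]. *)
Lemma last_visit m b : (m0 <= m)%N -> (m < b)%N ->
  F m m b = F m m m *m (tau *: (constmx (H m m.+1) *m F m.+1 m.+1 b)).
Proof.
move=> m0m mb; set T := tau *: _.
pose X a := F m a m *m T + (if (m < a)%N then F m.+1 a b else 0).
suff -> : F m m b = X m by rewrite /X ltnn addr0.
apply: (@step_unique m (fun a => (a == b)%:R%:M) (F m ^~ b) X _ _ m (leqnn m))
  => a ma; first exact: first_step.
rewrite /X first_step // mulmxDl stepD stepMr [RHS]addrCA -addrA.
rewrite [LHS]addrCA; congr (_ + _).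
rewrite [X in _ = _ + X]stepSl ?leqW // ltnn mulmx0 scaler0 add0r.
have -> : step m.+1 a (fun c => if (m < c)%N then F m.+1 c b else 0)
        = step m.+1 a (F m.+1 ^~ b).
  by congr (_ *: _); rewrite !big_nat; apply: eq_bigr => c /andP[-> _].
case: ltngtP ma => // [ma _|<- _].
  by rewrite (first_step b) // ?leqW // raddf0 mul0mx add0r.
(* At [a = m], the only step into the tail [m + 1] is the climb counted by [T]. *)
rewrite mul1mx addr0 (ltn_eqF mb) raddf0 add0r.
by rewrite /T /step big_nat1.
Qed.

(** The alternating product counts the ways to reach block [m + eta + 1] from
block [m] without coming back to it: climbs cannot skip a block, so one cuts at
the last visit to each block in between. *)
Lemma ascent m eta : (m0 <= m)%N ->
  tau ^+ eta.+1 *: \big[mulmx/1%:M]_(k < eta.+1)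
    (constmx (H (m + k)%N (m + k).+1) *m F (m + k).+1 (m + k).+1 (m + k).+1)
  = tau *: (constmx (H m m.+1) *m F m.+1 m.+1 (m + eta.+1)%N).
Proof.
elim: eta m => [|eta IH] m m0m.
  by rewrite big_ord_recl big_ord0 mulmx1 addn0 addn1 expr1.
rewrite big_ord_recl exprS -scalerA scalemxAr /=.
under eq_bigr do rewrite /bump add1n addnS -addSn.
have m0m1 := leqW m0m; rewrite (IH m.+1 m0m1) addn0 -mulmxA addSnnS.
by rewrite -(last_visit m0m1) // !addnS !ltnS leq_addr.
Qed.

(** The list [I] contains the numbers of blocks by which a single step may fall;
depth zero belongs to the diagonal block of [H] instead. *)
Variable I : seq nat.
Hypotheses (I_uniq : uniq I) (I_gt0 : {in I, forall eta, (0 < eta)%N}).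

(** A walk from a block [a > m] to block [m] splits at its first visit to block
[m], which it enters by a fall from some block [m + eta]; before the fall it is
a walk in the tail [m + 1]. *)
Lemma first_entrance m a : (m0 <= m)%N -> (m < a)%N ->
    (forall c, (m < c)%N -> (c - m)%N \notin I -> H c m = 0) ->
  F m a m = (\sum_(eta <- I) F m.+1 a (m + eta)%N *m constmx (H (m + eta)%N m))
            *m (tau *: F m m m).
Proof.
move=> m0m ma Hfall.
pose X a := (\sum_(eta <- I) F m.+1 a (m + eta)%N *m constmx (H (m + eta)%N m))
            *m (tau *: F m m m).
apply: (@step_unique m.+1 (fun a => tau *: (constmx (H a m) *m F m m m)) (F m ^~ m) X _ _ a ma)
  => {ma}b mb.
  rewrite [LHS](first_step m m0m (ltnW mb)) (gtn_eqF mb) raddf0 add0r.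
  by rewrite (stepSl _ (leqW (ltnW mb))) scalemxAr.
rewrite /X stepMr step_sum.
(* Only the depth [eta = b - m] falls directly from block [b] to block [m]. *)
have -> : constmx (H b m) =
    \sum_(eta <- I) (b == m + eta)%N%:R%:M *m constmx (H (m + eta)%N m).
  have bE eta : (b == m + eta)%N = (eta == b - m)%N.
    by rewrite -{1}(subnKC (ltnW mb)) eqn_add2l eq_sym.
  have [bI|bNI] := boolP (b - m \in I)%N.
    rewrite (bigD1_seq (b - m)%N) //= subnKC ?(ltnW mb) // eqxx mul1mx.
    rewrite big1 ?addr0 // => eta /negbTE etaN.
    by rewrite bE etaN raddf0 mul0mx.
  rewrite Hfall // constmx0 big1_seq // => eta /andP[_ etaI].
  by rewrite bE; case: eqP etaI bNI => [-> ->|_ _ _] //; rewrite raddf0 mul0mx.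
rewrite scalemxAr -mulmxDl -big_split; congr (_ *m _).
apply: eq_bigr => eta _ /=.
by rewrite stepMr -mulmxDl -first_step // leqW.
Qed.

(** A walk from block [m] to itself is empty, or starts inside block [m], or
starts with a climb to block [m + 1]; in the last case the first return to
block [m] splits it into an excursion and another such walk. *)
Lemma tail_recursion m : (m0 <= m)%N ->
    (forall c, (m < c)%N -> (c - m)%N \notin I -> H c m = 0) ->
  (1%:M - tau *: constmx (H m m)
   - \sum_(eta <- I) tau ^+ eta.+1 *:
       (\big[mulmx/1%:M]_(k < eta)
         (constmx (H (m + k)%N (m + k).+1) *m F (m + k).+1 (m + k).+1 (m + k).+1)
        *m constmx (H (m + eta)%N m))) *m F m m m = 1%:M.
Proof.
move=> m0m Hfall; rewrite 2!mulmxBl mul1mx.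
apply/eqP; rewrite 2!subr_eq; apply/eqP.
rewrite [LHS](first_step m m0m (leqnn m)) eqxx -addrA; congr (_ + _).
rewrite (stepSl _ (leqnSn m)) scalemxAl addrC; congr (_ + _).
rewrite /step big_nat1 (first_entrance m0m (ltnSn m) Hfall).
rewrite -2!scalemxAr mulmxA scalemxAl [LHS]scalemxAl; congr (_ *m _).
rewrite mulmx_sumr 2!scaler_sumr; apply: eq_big_seq => eta /I_gt0.
case: eta => [/notF[]|eta _].
rewrite exprS -scalerA (scalemxAl (tau ^+ _)) (ascent _ m0m).
by rewrite -scalemxAl mulmxA.
Qed.
End BlockHessenberg.

(** * The blocks have exactly q states *)

Section Residues.
Local Open Scope nat_scope.

(** As [Q] is invertible modulo [R], each of the [d] intervals of [R] consecutive
values of [k] contains exactly one solution. *)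
Lemma count_residue (Q R d h : nat) : 0 < R -> coprime R Q ->
  \sum_(k < d * R) (h == k * Q %[mod R]) = d.
Proof.
move=> R0 RQ; elim: d => [|d IH]; first by rewrite big_ord0.
rewrite mulSn addnC big_split_ord /= IH -addn1; congr (_ + _).
(* Multiplication by [Q] permutes the residues, so [h] has one preimage [k0]. *)
have inj : injective (fun k : 'I_R => Ordinal (ltn_pmod (k * Q) R0)).
  move=> k k' [] /eqP; wlog kk' : k k' / k <= k'.
    by move=> W; case: (leqP k k') => [/W //|/ltnW /W + /eqP E]; rewrite E => /(_ (eqxx _)).
  rewrite eq_sym eqn_mod_dvd ?leq_mul2r ?kk' ?orbT // -mulnBl Gauss_dvdl //.
  move=> /dvdn_leq L; apply/val_inj/eqP; rewrite /= eqn_leq kk' /= -subn_eq0.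
  by apply: contraT; rewrite -lt0n => /L; have := ltn_ord k'; lia.
have [g fg gf] := injF_bij inj.
pose k0 := g (Ordinal (ltn_pmod h R0)).
rewrite (bigD1 k0) //= big1 ?addn0.
  have /(congr1 val) /= E := gf (Ordinal (ltn_pmod h R0)).
  by rewrite mulnDl -mulnA mulnCA mulnC modnMDl ?E ?eqxx.
move=> k kk0; apply/eqP; rewrite eqb0; apply: contra kk0 => /eqP E.
rewrite -(fg k); apply/eqP; congr (g _); apply: val_inj => /=.
by rewrite E mulnDl mulnAC modnMDl.
Qed.
End Residues.

Section BlockStates.
Local Open Scope nat_scope.
Variables p q : nat.
Hypotheses (p_gt0 : 0 < p) (q_gt0 : 0 < q).
Local Notation P := (hP p q).
Local Notation Q := (hQ p q).
Local Notation R := (hR p q).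
Local Notation d := (hd p q).

Lemma hd_gt0 : 0 < d. Proof. by rewrite gcdn_gt0 p_gt0. Qed.
Lemma mul_hd_hP : d * P = p. Proof. by rewrite mulnC divnK // dvdn_gcdl. Qed.
Lemma mul_hd_hQ : d * Q = q. Proof. by rewrite mulnC divnK // dvdn_gcdr. Qed.
Lemma hP_gt0 : 0 < P. Proof. by have := p_gt0; rewrite -{1}mul_hd_hP muln_gt0 => /andP[]. Qed.
Lemma hQ_gt0 : 0 < Q. Proof. by have := q_gt0; rewrite -{1}mul_hd_hQ muln_gt0 => /andP[]. Qed.
Lemma hR_gt0 : 0 < R. Proof. by rewrite addn_gt0 hP_gt0. Qed.

Lemma coprime_hR_hQ : coprime R Q.
Proof.
rewrite /coprime gcdnC gcdnDr -/(coprime Q P) /coprime gcdnC.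
by rewrite -(eqn_pmul2l hd_gt0) muln_gcdr mul_hd_hP mul_hd_hQ muln1.
Qed.

Lemma omega_lshift (a : 'I_p) : omega (lshift q a) = a * Q.
Proof. by rewrite /omega; case: split_ordP => [b /lshift_inj <-|b /eqP]; rewrite ?eq_lrshift. Qed.

Lemma omega_rshift (b : 'I_q) : omega (rshift p b) = (q - b) * P.
Proof. by rewrite /omega; case: split_ordP => [c /eqP|c /rshift_inj <-]; rewrite ?eq_rlshift. Qed.

(** The inequality in the definition of a state is automatic in the blocks of
index at least [mstar]: all the [omega j] are at most [p Q]; and for [q = 1],
where [mstar] is zero, they are the residues smaller than [R], so that
[omega j] is the remainder of [h] as soon as the congruence holds. *)
Lemma is_stateE c h (j : 'I_(p + q)) : mstar p q <= c -> c * Q <= h ->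
  is_state (h, j) = (h == omega j %[mod R]).
Proof.
move=> mc ch; rewrite /is_state /=.
have [wh|hw] := leqP; first by rewrite eqn_mod_dvd.
have [q1|q1] := eqVneq q 1.
  suff wR : omega j < R.
    by rewrite /= (modn_small wR) (modn_small (ltn_trans hw wR)) ltn_eqF.
  have d1 : d = 1 by rewrite /hd q1 gcdn1.
  have [P1 Q1] : P = p /\ Q = 1 by rewrite /hP /hQ d1 !divn1.
  rewrite /hR P1 Q1; case: (split_ordP j) => i ->.
    by rewrite omega_lshift Q1 muln1 (ltn_trans (ltn_ord i)) // addn1.
  by rewrite omega_rshift P1 addn1 ltnS -{2}[p]mul1n leq_mul2r -{1}q1 leq_subr orbT.
have ph : p * Q <= h.
  apply: leq_trans ch; rewrite leq_mul2r (leq_trans _ mc) ?orbT //.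
  by rewrite /mstar (negbTE q1).
suff : omega j <= p * Q by lia.
case: (split_ordP j) => i ->.
  by rewrite omega_lshift leq_mul2r ltnW ?orbT.
have -> : p * Q = q * P by rewrite -{1}mul_hd_hP mulnAC mul_hd_hQ.
by rewrite omega_rshift leq_mul2r leq_subr orbT.
Qed.

(** After translation by [q Q], the index [rshift p b] has residue [b Q], since
[(q - b) P + q Q = (q - b) R + b Q], and [lshift q a] has residue
[(q + a) Q]. *)
Lemma count_height c h : mstar p q <= c -> c * Q <= h ->
  count (fun j => is_state (h, j)) (enum 'I_(p + q)) = d.
Proof.
move=> mc ch; rewrite -sum1_count big_enum_cond /= big_mkcond big_split_ord /=.
rewrite -(count_residue d (h + q * Q) hR_gt0 coprime_hR_hQ).
have -> : d * R = q + p by rewrite mulnDr mul_hd_hP mul_hd_hQ addnC.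
rewrite big_split_ord addnC; congr (_ + _); apply: eq_bigr => /= i _.
  rewrite (is_stateE _ mc ch) omega_rshift -(eqn_modDr (q * Q)).
  have -> : (q - i) * P + q * Q = (q - i) * R + i * Q.
    by rewrite mulnDr -addnA -mulnDl subnK // ltnW.
  by rewrite modnMDl; case: eqP.
rewrite (is_stateE _ mc ch) omega_lshift -(eqn_modDr (q * Q)) -mulnDl addnC [i + q]addnC addnC.
by case: eqP.
Qed.

Lemma size_block c : mstar p q <= c -> size (block p q c) = q.
Proof.
move=> mc; rewrite size_pmap_sub /allpairs_dep.
have ch h : h \in iota (c * Q) Q -> c * Q <= h by rewrite mem_iota => /andP[].
transitivity (d * size (iota (c * Q) Q)); last by rewrite size_iota mul_hd_hQ.
elim: (iota _ _) ch => [|h s IH] ch; first by rewrite muln0.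
rewrite /= count_cat count_map IH; last by move=> x xs; rewrite ch // inE xs orbT.
by rewrite mulnS -(count_height mc (ch h _)) ?inE ?eqxx.
Qed.

Lemma block_uniq c : uniq (block p q c).
Proof.
apply: pmap_sub_uniq; apply: allpairs_uniq => //; rewrite ?iota_uniq ?enum_uniq //.
by move=> [? ?] [? ?].
Qed.

Lemma mem_block c (s : state p q) :
  (s \in block p q c) = (c * Q <= height s < c.+1 * Q).
Proof.
rewrite mem_pmap_sub mulSnr -mem_iota /height; case: (val s) => h j /=.
apply/allpairsP/idP => [[[h' j'] /= [hI _ [-> _]]] //|hI].
by exists (h, j); rewrite mem_enum.
Qed.

Definition lists_blocks (x : nat -> 'I_q -> state p q) : Prop :=
  forall c, mstar p q <= c ->
  [/\ forall (i : 'I_q) s, (onth (block p q c) i == Some s) = (s == x c i),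
      injective (x c),
      forall i, c * Q <= height (x c i) < c.+1 * Q
    & forall s, c * Q <= height s < c.+1 * Q -> exists i, s = x c i].

Lemma block_states : exists x, lists_blocks x.
Proof.
(* The default value of [nth]; the block [mstar] shows that there is a state. *)
have s0 : state p q.
  have := size_block (leqnn (mstar p q)); move: q_gt0.
  by case: (block _ _ _) => [|s //]; case: q.
exists (fun c i => nth s0 (block p q c) i) => c mc.
have sz := size_block mc.
split.
- move=> i s; have := onthTE (block p q c) i; rewrite sz ltn_ord.
  case E: onth => [t|] // _; rewrite (@onth_nth _ s0 _ _ _ E) eq_sym.
  by apply/eqP/eqP => [[]|->].
- by move=> i j /eqP; rewrite nth_uniq ?sz ?block_uniq // => /eqP/val_inj.
- by move=> i; rewrite -mem_block mem_nth ?sz.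
move=> s; rewrite -mem_block => sb.
have sb' : index s (block p q c) < q by move: sb; rewrite -index_mem sz.
by exists (Ordinal sb'); rewrite nth_index.
Qed.
End BlockStates.

(** * Block coordinates for the height-ordered matrix *)

Section FiniteSupport.
Variable V : nmodType.

Lemma fsbig_reindex (T : finType) (U : choiceType) (g : T -> U) (f : U -> V) :
    injective g -> (forall r, (forall t, r != g t) -> f r = 0) ->
  \sum_(r \in [set: U]%classic) f r = \sum_t f (g t).
Proof.
move=> g_inj f0; rewrite (@fsbigE _ _ _ _ _ [seq g t | t <- enum T]).
- rewrite big_map big_enum_cond /=; apply: eq_bigl => t.
  by rewrite in_setT.
- by rewrite map_inj_uniq ?enum_uniq.
- by [].
move=> r _ rN; apply: f0 => t; apply: contraNneq rN => ->.
by rewrite map_f ?mem_enum.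
Qed.

Lemma fsbig_single (U : choiceType) (u : U) (f : U -> V) :
  (forall r, r != u -> f r = 0) -> \sum_(r \in [set: U]%classic) f r = f u.
Proof.
move=> f0; rewrite (@fsbig_reindex unit U (fun=> u)) ?big_const ?card_unit /= ?addr0 //.
  by move=> [] [].
by move=> r /(_ tt); apply: f0.
Qed.
End FiniteSupport.

Section Coordinates.
Variables (K : comUnitRingType) (p q : nat).
Hypothesis q_gt0 : (0 < q)%N.
Variables (l : 'I_p -> nat -> K) (u : 'I_q -> nat -> K).
Variable x : nat -> 'I_q -> state p q.
Hypothesis xP : lists_blocks x.
Local Notation P := (hP p q).
Local Notation Q := (hQ p q).
Local Notation H := (Hblock l u).

Lemma EmxE (A : nzRingType) c s i : (mstar p q <= c)%N ->
  Emx A c s i = (s == x c i)%:R.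
Proof. by case/xP => xE _ _ _; rewrite /Emx xE. Qed.

Lemma x_eq a b i j : (mstar p q <= a)%N -> (mstar p q <= b)%N ->
  (x a i == x b j) = (a == b) && (i == j).
Proof.
move=> ma mb; have [_ inja ha _] := xP ma; have [_ _ hb _] := xP mb.
have [ab|nab] := eqVneq a b; first by rewrite -ab (inj_eq inja).
apply/negbTE; apply: contra nab => /eqP E; move: (hb j) (ha i); rewrite E.
have := hQ_gt0 p q_gt0; nia.
Qed.

Lemma HblockE a b i j : (mstar p q <= a)%N -> (mstar p q <= b)%N ->
  H a b i j = Hmx l u (x a i) (x b j).
Proof.
move=> ma mb; rewrite mxE /imul (fsbig_single (u := x b j)).
  rewrite (fsbig_single (u := x a i)) /itr ?EmxE ?eqxx ?mulr1 ?mul1r //.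
  by move=> r /negbTE rN; rewrite EmxE ?rN ?mul0r.
by move=> r /negbTE rN; rewrite [X in _ * X]EmxE ?rN ?mulr0.
Qed.

Lemma Hmx_neq0 s t : Hmx l u s t != 0 ->
  (height t == height s + Q)%N || (height t + P == height s)%N.
Proof.
rewrite /Hmx; case: ifP => _; first by rewrite eqxx.
case: (height t == _)%N => //; case: (_ == height s)%N => //.
by rewrite eqxx.
Qed.

Lemma Hmx_level a s t : Hmx l u s t != 0 ->
  (height s < a.+1 * Q)%N -> (height t %/ Q < a.+2)%N.
Proof.
move=> /Hmx_neq0 st sa; rewrite ltn_divLR ?hQ_gt0 //.
by rewrite mulSn; case/orP: st => /eqP st; lia.
Qed.

Fixpoint path_weight m n a b : 'M[K]_q :=
  if n is n'.+1 then \sum_(m <= c < a.+2) H a c *m path_weight m n' c b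
  else (a == b)%:R%:M.

(** Tail states correspond to pairs (block, position in the block), so powers of
the tail matrix can be computed blockwise with finite sums. *)
Lemma ipow_tail m n a b i j (s t : tail_state p q m) :
    (mstar p q <= m)%N -> (m <= a)%N -> (m <= b)%N ->
    val s = x a i -> val t = x b j ->
  ipow (@Htail p q K l u m) n s t = path_weight m n a b i j.
Proof.
move=> mm ma mb; elim: n a i s ma => [|n IH] a i s ma si tj.
  rewrite /= /ione mxE -val_eqE si tj x_eq ?(leq_trans mm) //.
  by case: eqP; case: eqP.
have tailP (c : 'I_(a.+2 - m)) k : (m * Q <= height (x (c + m) k))%N.
  have [_ _ /(_ k)/andP[+ _] _] := xP (leq_trans mm (leq_addl c m)).
  by apply: leq_trans; rewrite leq_mul2r leq_addl orbT.
pose g (c : 'I_(a.+2 - m)) k : tail_state p q m := Sub (x (c + m)%N k) (tailP c k).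
have sum_shift N (f : nat -> K) :
    \sum_(m <= c < N) f c = \sum_(c < N - m) f (c + m)%N.
  by rewrite -{1}[m]add0n big_addn big_mkord.
rewrite [LHS]/= /imul (@fsbig_reindex _ _ _ (fun k => g k.1 k.2)).
- rewrite /= summxE sum_shift.
  rewrite -(pair_bigA _ (fun c k => Htail l u s (g c k) *
                                    ipow (@Htail p q K l u m) n (g c k) t)) /=.
  apply: eq_bigr => c _; rewrite mxE; apply: eq_bigr => k _.
  rewrite (IH (c + m)%N k) ?leq_addl // HblockE ?(leq_trans mm) ?leq_addl //.
  by rewrite /Htail si.
- move=> [c k] [c' k'] /(congr1 val)/eqP /=.
  by rewrite x_eq ?(leq_trans mm) ?leq_addl // eqn_add2r => /andP[/eqP/val_inj -> /eqP ->].
(* A state reached in one step lies in some block [c] with [m <= c < a + 2]. *)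
move=> r rN; apply/eqP; apply: contraT => rn0; exfalso.
have hr : Hmx l u (val s) (val r) != 0.
  by apply: contraNneq rn0; rewrite -/(Htail l u s r) => ->; rewrite mul0r.
have [_ _ /(_ i)/andP[_ ha] _] := xP (leq_trans mm ma).
have Q0 := hQ_gt0 p q_gt0.
pose c := (height (val r) %/ Q)%N.
have rc : (c * Q <= height (val r) < c.+1 * Q)%N by rewrite leq_divM /= ltn_ceil.
have mc : (m <= c)%N by rewrite leq_divRL //; exact: valP r.
have ca : (c - m < a.+2 - m)%N.
  rewrite ltn_sub2r //; first by rewrite ltnS leqW.
  by apply: Hmx_level hr _; rewrite si.
have [_ _ _ /(_ _ rc)[k rk]] := xP (leq_trans mm mc).
by have /eqP[] := rN (Ordinal ca, k); apply: val_inj => /=; rewrite subnK.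
Qed.

Definition path_series m a b : 'M[fps K]_q :=
  \matrix_(i, j) Fps (fun n => path_weight m n a b i j).

Lemma Gmx_path_series m : (mstar p q <= m)%N ->
  Gmx l u m = path_series m m m.
Proof.
move=> mm; have [_ _ hx _] := xP mm.
have tailP i : (m * Q <= height (x m i))%N by case/andP: (hx i).
pose g i : tail_state p q m := Sub (x m i) (tailP i).
have EE (s : tail_state p q m) i : Etail (fps K) s i = (s == g i)%:R.
  by rewrite /Etail EmxE.
apply/matrixP => i j; rewrite mxE /imul (fsbig_single (u := g j)); last first.
  by move=> r /negbTE rN; rewrite EE rN mulr0.
rewrite EE eqxx mulr1 (fsbig_single (u := g i)); last first.
  by move=> r /negbTE rN; rewrite /itr EE rN mul0r.
rewrite /itr EE eqxx mul1r mxE; congr Fps; apply/funext => n.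
exact: ipow_tail.
Qed.

Lemma path_series_first_step m a b :
  path_series m a b = (a == b)%:R%:M + step H m a (path_series m ^~ b).
Proof.
apply/matrixP => i j; apply/fpsP => n.
rewrite [path_series m a b i j]mxE [X in _ = fpscoef X _]mxE fpscoefD fpscoef_step.
case: n => [|n] /=.
  rewrite addr0 !mxE; case: (a == b); case: (i == j) => //=.
rewrite !mxE; set z := fpscoef _ _; have -> : z = 0.
  by rewrite {}/z; case: (a == b); case: (i == j).
rewrite add0r summxE; apply: eq_bigr => c _; rewrite mxE.
by apply: eq_bigr => k _; rewrite [path_series m c b k j]mxE.
Qed.

Lemma Hblock_neq0 a b : (mstar p q <= a)%N -> (mstar p q <= b)%N ->
    H a b != 0 -> exists s t : state p q,
  [/\ (a * Q <= height s < a.+1 * Q)%N, (b * Q <= height t < b.+1 * Q)%N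
    & (height t == height s + Q)%N || (height t + P == height s)%N].
Proof.
move=> ma mb /eqP Hn0; apply: contra_notP Hn0 => HN.
apply/matrixP => i j; rewrite [RHS]mxE HblockE //; apply/eqP; apply: contraT => /Hmx_neq0 st.
have [_ _ ha _] := xP ma; have [_ _ hb _] := xP mb.
by case: HN; exists (x a i), (x b j).
Qed.

(** A fall lowers the height by [P = kappa Q + sigma] with [0 <= sigma < Q], that
is, by [kappa] or [kappa + 1] blocks according to the position in the block. *)
Lemma fall_depth m c : (mstar p q <= m)%N -> (m < c)%N ->
  (c - m)%N \notin Iplus p q -> H c m = 0.
Proof.
move=> mm mc; apply: contraNeq => /(Hblock_neq0 (leq_trans mm (ltnW mc)) mm).
case=> s [t [/andP[s1 s2] /andP[t1 t2] st]].
rewrite mem_filter !inE subn_gt0 mc /=.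
have Q0 := hQ_gt0 p q_gt0.
have := divn_eq P Q; rewrite -/(kappa p q) => PE.
have sQ : (P %% Q < Q)%N by rewrite ltn_pmod.
case/orP: st => /eqP st; first by nia.
suff : (c - m = kappa p q \/ c - m = (kappa p q).+1)%N by case=> ->; rewrite eqxx ?orbT.
have : (kappa p q <= c - m <= (kappa p q).+1)%N by nia.
lia.
Qed.

Lemma Dmx_sigma0 m : (mstar p q <= m)%N -> sigma p q = 0%N ->
  Dmx l u m (kappa p q).+1 = 0.
Proof.
move=> mm s0; have mk := leq_trans mm (leq_addr (kappa p q).+1 m).
apply/eqP; apply: contraT => /(Hblock_neq0 mk mm)[s [t [/andP[s1 s2] /andP[t1 t2] st]]].
have Q0 := hQ_gt0 p q_gt0.
have := divn_eq P Q; rewrite -/(kappa p q) -/(sigma p q) s0 addn0 => PE.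
by case/orP: st => /eqP st; nia.
Qed.
End Coordinates.

(** * The recursion for the tails *)

Theorem theorem4p2 (R : realType) (p q : nat) (hp : (1 <= p)%N) (hq : (1 <= q)%N)
    (l : 'I_p -> nat -> R[i]) (u : 'I_q -> nat -> R[i])
    (m : nat) (hm : (mstar p q <= m)%N) :
  let G := Gmx l u in
  let A := Amx l u in
  let B := Bmx l u in
  let D := Dmx l u in
  let Delta := 1%:M - fpsX R[i] *: constmx (A m)
           - \sum_(eta <- Iplus p q)
               fpsX R[i] ^+ eta.+1 *:
                 (BGprod l u m eta *m constmx (D m eta)) in
  [/\ Delta \in unitmx,
      G m = invmx Delta,
      BGprod l u m 1 = constmx (B m) *m G m.+1,
      sigma p q = 0%N -> D m (kappa p q).+1 = 0 &
      kappa p q = 0%N -> D m 0%N = A m /\ 0%N \notin Iplus p q].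
Proof.
move=> G A B D Delta.
have [x xP] := block_states hp hq.
have GE := Gmx_path_series hq l u xP.
have fs m' a b (_ : (mstar p q <= m')%N) (_ : (m' <= a)%N) :=
  path_series_first_step l u m' a b.
have I_uniq : uniq (Iplus p q) by rewrite filter_uniq //= inE eq_sym gtn_eqF.
have I_gt0 : {in Iplus p q, forall eta, (0 < eta)%N}.
  by move=> eta; rewrite mem_filter => /andP[].
have DeltaG : Delta *m G m = 1%:M.
  apply: etrans (tail_recursion fs I_uniq I_gt0 hm
                   (fun c => @fall_depth _ _ _ hq l u x xP m c hm)).
  apply: (congr2 mulmx _ (GE m hm)).
  apply: (congr1 (fun Z => _ - Z)); apply: eq_bigr => eta _.
  apply: (congr1 (fun Z => _ *: (Z *m _))); apply: eq_bigr => k _.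
  by apply: (congr2 mulmx (erefl _) (GE _ _)); lia.
have [DU _] := mulmx1_unit DeltaG.
split=> //.
- by rewrite -[LHS]mul1mx -(mulVmx DU) -mulmxA DeltaG mulmx1.
- by rewrite /BGprod big_ord_recl big_ord0 mulmx1 /= addn0.
- exact: (Dmx_sigma0 hq l u xP hm).
by move=> k0; rewrite /D /Dmx addn0 /Iplus k0.
Qed.
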